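(* For every scheme $\mathbf{X}\in\mathcal{S}$, the following split interpolation property fails: for all formulas $\phi,\psi\in\mathcal{L}$, if $\mathit{At}(\phi)\cap\mathit{At}(\psi)\neq\emptyset$ and $\models_{\mathbf{X}}^{\mathbf{st}}\phi\Rightarrow\psi$, then there is a formula $\chi\in\mathcal{L}$ with $\mathit{At}(\chi)\subseteq\mathit{At}(\phi)\cap\mathit{At}(\psi)$ such that $\models_{\mathbf{X}}^{\mathbf{ss}}\phi\Rightarrow\chi$ and $\models_{\mathbf{X}}^{\mathbf{st}}\chi\Rightarrow\psi$.
   Context: Language: $\mathit{Var}$ is a countably infinite set of atoms; $\mathcal{L}$ is the set of formulas built from $\mathit{Var}$ using unary $\neg$ and binary $\wedge,\lor$ (no propositional constants). $\mathit{At}(\phi)$ is the set of atoms occurring in $\phi$. Schemes: let $\mathcal{V}=\{0,\frac12,1\}$. A scheme is a triple $\mathbf{X}=\langle f^\neg,f^\wedge,f^\lor\rangle$ of operations on $\mathcal{V}$ (of arities 1, 2, 2). An $\mathbf{X}$-valuation is a map $v:\mathcal{L}\to\mathcal{V}$ with $v(\neg\phi)=f^\neg(v(\phi))$, $v(\phi\wedge\chi)=f^\wedge(v(\phi),v(\chi))$, $v(\phi\lor\chi)=f^\lor(v(\phi),v(\chi))$ (arbitrary on atoms). All schemes considered here satisfy $f^\neg(1)=0$, $f^\neg(\frac12)=\frac12$, $f^\neg(0)=1$; $f^\wedge$ and $f^\lor$ are classical on $\{0,1\}$; $f^\wedge(1,\frac12)=f^\wedge(\frac12,1)=f^\wedge(\frac12,\frac12)=\frac12$;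 $f^\lor(0,\frac12)=f^\lor(\frac12,0)=f^\lor(\frac12,\frac12)=\frac12$. The scheme $\mathbf{X}_\wedge/\mathbf{Y}_\lor$ is determined by the remaining values: - the pair $(f^\wedge(0,\frac12),f^\wedge(\frac12,0))$ is $(\frac12,\frac12)$ for $\mathbf{WK}_\wedge$, $(0,\frac12)$ for $\mathbf{LMK}_\wedge$, $(\frac12,0)$ for $\mathbf{RMK}_\wedge$; - the pair $(f^\lor(1,\frac12),f^\lor(\frac12,1))$ is $(\frac12,\frac12)$ for $\mathbf{WK}_\lor$, $(1,\frac12)$ for $\mathbf{LMK}_\lor$, $(\frac12,1)$ for $\mathbf{RMK}_\lor$. The set $\mathcal{S}$ consists of the eight schemes $\mathbf{LMK}_{\wedge}/\mathbf{LMK}_{\lor}$, $\mathbf{LMK}_{\wedge}/\mathbf{RMK}_{\lor}$, $\mathbf{LMK}_{\wedge}/\mathbf{WK}_{\lor}$, $\mathbf{RMK}_{\wedge}/\mathbf{LMK}_{\lor}$, $\mathbf{RMK}_{\wedge}/\mathbf{RMK}_{\lor}$, $\mathbf{RMK}_{\wedge}/\mathbf{WK}_{\lor}$, $\mathbf{WK}_{\wedge}/\mathbf{LMK}_{\lor}$, $\mathbf{WK}_{\wedge}/\mathbf{RMK}_{\lor}$. Consequence: let $\mathbf{s}=\{1\}$, $\mathbf{t}=\{1,\frac12\}$. For $\mathbf{x},\mathbf{y}\in\{\mathbf{s},\mathbf{t}\}$, $\models_{\mathbf{X}}^{\mathbf{xy}}\phi\Rightarrow\psi$ means: for every $\mathbf{X}$-valuation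 $v$, if $v(\phi)\in\mathbf{x}$ then $v(\psi)\in\mathbf{y}$. *)

(* Defs.v *)
From mathcomp Require Import all_boot.
From mathcomp Require Import finmap.

Set Implicit Arguments.
Unset Strict Implicit.
Unset Printing Implicit Defensive.

Local Open Scope fset_scope.

Inductive formula (Var : Type) : Type :=
  | Atom of Var
  | Neg of formula Var
  | And of formula Var & formula Var
  | Or of formula Var & formula Var.

Fixpoint At (Var : choiceType) (phi : formula Var) : {fset Var} :=
  match phi with
  | Atom p => [fset p]
  | Neg chi => At chi
  | And chi xi => At chi `|` At xi
  | Or chi xi => At chi `|` At xi
  end.

Inductive tval : Type := Zero | Half | One.

Record scheme : Type := Scheme {
  fneg : tval -> tval;
  fand : tval -> tval -> tval;
  for_ : tval -> tval -> tval
}.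

Definition valuation (Var : Type) (X : scheme) (v : formula Var -> tval) : Prop :=
  [/\ forall phi, v (Neg phi) = fneg X (v phi),
      forall phi chi, v (And phi chi) = fand X (v phi) (v chi)
    & forall phi chi, v (Or phi chi) = for_ X (v phi) (v chi)].

Definition kneg (a : tval) : tval :=
  match a with Zero => One | Half => Half | One => Zero end.

(* The conjunction with value [a] at (0, 1/2) and [b] at (1/2, 0). *)
Definition kand (a b : tval) (x y : tval) : tval :=
  match x, y with
  | Zero, Half => a
  | Half, Zero => b
  | Half, _ | _, Half => Half
  | One, One => One
  | _, _ => Zero
  end.

(* The disjunction with value [a] at (1, 1/2) and [b] at (1/2, 1). *)
Definition kor (a b : tval) (x y : tval) : tval :=
  match x, y with
  | One, Half => a
  | Half, One => b
  | Half, _ | _, Half => Half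
  | Zero, Zero => Zero
  | _, _ => One
  end.

(* Weak, left-middle and right-middle Kleene. *)
Inductive kleene : Type := WK | LMK | RMK.

Definition kleene_and (k : kleene) : tval -> tval -> tval :=
  match k with
  | WK => kand Half Half
  | LMK => kand Zero Half
  | RMK => kand Half Zero
  end.

Definition kleene_or (k : kleene) : tval -> tval -> tval :=
  match k with
  | WK => kor Half Half
  | LMK => kor One Half
  | RMK => kor Half One
  end.

(* The scheme k_/\ / l_\/. *)
Definition kleene_scheme (k l : kleene) : scheme :=
  Scheme kneg (kleene_and k) (kleene_or l).

Inductive in_S : scheme -> Prop :=
  | S_LMK_LMK : in_S (kleene_scheme LMK LMK)
  | S_LMK_RMK : in_S (kleene_scheme LMK RMK)
  | S_LMK_WK : in_S (kleene_scheme LMK WK)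
  | S_RMK_LMK : in_S (kleene_scheme RMK LMK)
  | S_RMK_RMK : in_S (kleene_scheme RMK RMK)
  | S_RMK_WK : in_S (kleene_scheme RMK WK)
  | S_WK_LMK : in_S (kleene_scheme WK LMK)
  | S_WK_RMK : in_S (kleene_scheme WK RMK).

(* The sets s = {1} and t = {1, 1/2}. *)
Inductive standard : Type := Strict | Tolerant.

Definition satisfies (x : standard) (a : tval) : Prop :=
  match x with
  | Strict => a = One
  | Tolerant => a = One \/ a = Half
  end.

Definition entails (Var : Type) (X : scheme) (x y : standard)
    (phi psi : formula Var) : Prop :=
  forall v : formula Var -> tval, valuation X v ->
    satisfies x (v phi) -> satisfies y (v psi).

Definition split_interpolation (Var : choiceType) (X : scheme) : Prop :=
  forall phi psi : formula Var,
    At phi `&` At psi != fset0 ->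
    entails X Strict Tolerant phi psi ->
    exists chi : formula Var,
      [/\ At chi `<=` At phi `&` At psi,
          entails X Strict Strict phi chi
        & entails X Strict Tolerant chi psi].

(* Main.v *)
Require Import Defs.
From mathcomp Require Import all_boot.
From mathcomp Require Import finmap.

(** In every scheme of S one of the connectives short-circuits: a classical
    argument on one side decides the value even though the other argument is
    1/2.  Hence some formula phi built from a private atom q and an atom p takes
    the value 1 while p has the value 1/2 ([short_circuit_formula]).  The value
    1/2 is a fixed point of all the operations, so a formula chi whose only atom
    is p has the value 1/2 under such a valuation ([eval_half]), and the premise
    phi cannot strictly entail it.  It remains to choose a conclusion psi with
    the single atom p that is entailed by phi: excluded middle for p is never
    false, so any premise entails it tolerantly ([excluded_middle_tolerant]). *)

Section Evaluation.

Variable Var : choiceType.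
Implicit Types (X : scheme) (e : Var -> Defs.tval) (phi chi : formula Var).

Fixpoint eval X e phi : Defs.tval :=
  match phi with
  | Atom p => e p
  | Neg chi => fneg X (eval X e chi)
  | And chi xi => fand X (eval X e chi) (eval X e xi)
  | Or chi xi => for_ X (eval X e chi) (eval X e xi)
  end.

Lemma eval_valuation X e : valuation X (eval X e).
Proof. by []. Qed.

(** All the connectives map the value 1/2 on every argument to 1/2. *)
Lemma eval_half k l e chi :
  {in At chi, forall p, e p = Half} -> eval (kleene_scheme k l) e chi = Half.
Proof.
elim: chi => [p|chi IH|chi IHc xi IHx|chi IHc xi IHx] /= half.
- by apply: half; rewrite in_fset1.
- by rewrite IH.
- rewrite IHc ?IHx; first by case: k {IHc IHx}.
  + by move=> p px; apply: half; rewrite in_fsetU px orbT.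
  + by move=> p pc; apply: half; rewrite in_fsetU pc.
- rewrite IHc ?IHx; first by case: l {IHc IHx}.
  + by move=> p px; apply: half; rewrite in_fsetU px orbT.
  + by move=> p pc; apply: half; rewrite in_fsetU pc.
Qed.

Lemma excluded_middle_tolerant k l x phi (p : Var) :
  entails (kleene_scheme k l) x Tolerant phi (Or (Atom p) (Neg (Atom p))).
Proof.
move=> v [vN _ vO] _; rewrite vO vN.
by case: l vN vO => _ _; case: (v (Atom p)) => /=; by [left | right].
Qed.

(** The short-circuiting disjunction serves directly; when the disjunction is
    weak Kleene, the conjunction short-circuits and yields q \/ p (or p \/ q)
    through De Morgan duality. *)
Lemma short_circuit_formula X (p q : Var) : in_S X ->
  exists2 phi, At phi =i [fset p; q]%fset &
    forall e, e p = Half -> e q = One -> eval X e phi = One.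
Proof.
pose orL := Or (Atom q) (Atom p); pose orR := Or (Atom p) (Atom q).
pose andL := Neg (And (Neg (Atom q)) (Atom p)).
pose andR := Neg (And (Atom p) (Neg (Atom q))).
by case; [exists orL | exists orR | exists andL | exists orL | exists orR
         | exists andR | exists orL | exists orR];
   (* For orL and andL the atoms occur in the order q, p. *)
   try (by move=> e /= -> ->); move=> r; rewrite !inE //= orbC.
Qed.

End Evaluation.

Theorem theorem4p16 (Var : choiceType)
    (Var_countably_infinite : exists f : nat -> Var, bijective f)
    (X : scheme) (X_in_S : in_S X) :
  ~ split_interpolation Var X.
Proof.
have [f /bij_inj f_inj] := Var_countably_infinite.
pose p := f 0; pose q := f 1.
have qp : q != p by rewrite (inj_eq f_inj).
have [k [l XE]] : exists k l, X = kleene_scheme k l.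
  by case: X_in_S; do 2 eexists.
have [phi At_phi phi1] := short_circuit_formula _ X p q X_in_S.
move=> /(_ phi (Or (Atom p) (Neg (Atom p)))) [||chi [At_chi phi_chi _]].
- by apply/fset0Pn; exists p; rewrite in_fsetI At_phi !inE eqxx.
- by rewrite XE; apply: excluded_middle_tolerant.
pose e r := if r == p then Half else One.
have ep : e p = Half by rewrite /e eqxx.
have eq1 : e q = One by rewrite /e (negbTE qp).
have := phi_chi _ (eval_valuation _ X e) (phi1 e ep eq1).
rewrite /= XE eval_half // => r /(fsubsetP At_chi).
by rewrite in_fsetI /= !inE orbb => /andP[_ /eqP ->].
Qed.
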